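(* Let $\theta^0,\theta^\infty_1,\theta^\infty_2,\theta^\infty_3\in\mathbb{C}$ with $2\theta^0+2\theta^\infty_1+\theta^\infty_2+\theta^\infty_3=0$ and $\theta^\infty_2\neq\theta^\infty_3$. Let $q_1,p_1,q_2,p_2,v$ be holomorphic functions of $t$ and $U$ a holomorphic $2\times2$-matrix function of $t$ on a domain of $\mathbb{C}\setminus\{0\}$, with $v\ne0$ and $\det U\neq0$. Put $$Q=\begin{pmatrix} q_1&1\\-q_2&q_1\end{pmatrix},\quad P=\begin{pmatrix} p_1/2&-p_2\\ p_2q_2-\theta^0-\theta^\infty_1-\theta^\infty_2&p_1/2\end{pmatrix},\quad \Theta=\begin{pmatrix}\theta^\infty_2&0\\0&\theta^\infty_3\end{pmatrix},\quad G=U\oplus\mathrm{diag}(v,1),$$ $$Z=(QP+\theta^0+2\theta^\infty_1)P-(QP+\theta^0+\theta^\infty_1),$$ and in $2\times2$ blocks (scalars meaning multiples of $I=I_2$) $$\hat A_0^{(-1)}=\begin{pmatrix}I\\P\end{pmatrix}\begin{pmatrix}t(I-P)&tI\end{pmatrix},\quad \hat A_0^{(0)}=\begin{pmatrix}-\theta^\infty_1I&-Q\\-Z&-\Theta\end{pmatrix},\quad \hat A_\infty=\begin{pmatrix}-I&O\\O&O\end{pmatrix}.$$ Consider the linear systems $$\frac{\partial Y}{\partial x}=AY,\quad A=G^{-1}\left(\frac{\hat A_0^{(-1)}}{x^2}+\frac{\hat A_0^{(0)}}{x}+\hat A_\infty\right)G,\qquad \frac{\partial Y}{\partial t}=BY,\quad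 B=-\frac{1}{tx}\,G^{-1}\hat A_0^{(-1)}G .$$ Then the compatibility condition $\partial_tA-\partial_xB+[A,B]=O$ (for all $x$) is equivalent to the Hamiltonian system $$\frac{dq_i}{dt}=\frac{\partial H}{\partial p_i},\quad \frac{dp_i}{dt}=-\frac{\partial H}{\partial q_i}\ (i=1,2),\qquad tH=\mathrm{tr}\left[Q^2P^2-\left(Q^2-(\theta^0+2\theta^\infty_1)Q-t\right)P-(\theta^0+\theta^\infty_1)Q\right],$$ together with $$t\frac{dU}{dt}=\begin{pmatrix}(2p_2q_1-p_1+1)q_1&p_1-2p_2q_1-1\\2q_1(p_2q_2-\theta^0-\theta^\infty_1-\theta^\infty_2)-(p_1-1)q_2&2p_2q_2+(p_1-1)q_1+\theta^0+2\theta^\infty_1\end{pmatrix}U,$$ $$\frac tv\frac{dv}{dt}=2p_2(q_1^2-q_2)-2(p_1-1)q_1+\theta^0+2\theta^\infty_2 .$$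
   Context: This is the matrix Painlevé system $H^{\mathrm{Mat}}_{\mathrm{III}(D_6)}$, attached to linear systems with two irregular singularities $x=0,\infty$ of spectral type $(2)(2),(2)(11)$. $H$ is regarded as a function of $q_1,p_1,q_2,p_2,t$ by inserting the displayed matrices. $\oplus$ denotes block-diagonal sum. *)

(* Defs.v *)
From HB Require Import structures.
From mathcomp Require Import all_boot all_order all_algebra.
From mathcomp Require Import complex.
From mathcomp Require Import all_classical reals topology normedtype derive.

Set Implicit Arguments.
Unset Strict Implicit.
Unset Printing Implicit Defensive.

Import Order.TTheory GRing.Theory Num.Theory.
Import numFieldNormedType.Exports.

Local Open Scope classical_set_scope.
Local Open Scope ring_scope.

(* [R[i]] packaged as a [numFieldType], so that the topology and the normed
   module structure over itself are inferred on it; [derivable _ _ 1] and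
   [derive1] at this type are then complex differentiability and the complex
   derivative. *)
Definition Cplx (R : realType) : numFieldType := R[i].

Definition complex_domain (K : numFieldType) (D : set K) : Prop :=
  [/\ open D, connected D & D !=set0].

Definition holomorphic_on (K : numFieldType) (V : normedModType K) (D : set K)
    (f : K -> V) : Prop :=
  forall t, D t -> derivable f t 1.

Definition mx22 (K : numFieldType) (a b c d : K) : 'M[K]_2 :=
  \matrix_(i < 2, j < 2)
    if i == 0 then (if j == 0 then a else b) else (if j == 0 then c else d).

(* The parameters [th0 thi1 thi2 thi3] are theta^0, theta^oo_1, theta^oo_2,
   theta^oo_3. *)
Section MatrixPIIID6.
Variables (K : numFieldType) (th0 thi1 thi2 thi3 : K).

Definition Qmx (q1 q2 : K) : 'M[K]_2 := mx22 q1 1 (- q2) q1.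

Definition Pmx (p1 q2 p2 : K) : 'M[K]_2 :=
  mx22 (p1 / 2%:R) (- p2) (p2 * q2 - th0 - thi1 - thi2) (p1 / 2%:R).

Definition Thetamx : 'M[K]_2 := mx22 thi2 0 0 thi3.

Definition Zmx (q1 p1 q2 p2 : K) : 'M[K]_2 :=
  let Q := Qmx q1 q2 in let P := Pmx p1 q2 p2 in
  (Q * P + (th0 + 2%:R * thi1)%:M) * P - (Q * P + (th0 + thi1)%:M).

Definition Gmx (v : K) (U : 'M[K]_2) : 'M[K]_(2 + 2) :=
  block_mx U 0 0 (mx22 v 0 0 1).

Definition hatA0m1 (p1 q2 p2 t : K) : 'M[K]_(2 + 2) :=
  let P := Pmx p1 q2 p2 in
  col_mx 1%:M P *m row_mx (t *: (1%:M - P)) t%:M.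

Definition hatA00 (q1 p1 q2 p2 : K) : 'M[K]_(2 + 2) :=
  block_mx (- thi1)%:M (- Qmx q1 q2) (- Zmx q1 p1 q2 p2) (- Thetamx).

Definition hatAinf : 'M[K]_(2 + 2) := block_mx (- 1%:M) 0 0 0.

Definition Amx (q1 p1 q2 p2 v : K) (U : 'M[K]_2) (t x : K) : 'M[K]_(2 + 2) :=
  let G := Gmx v U in
  invmx G *m (x ^- 2 *: hatA0m1 p1 q2 p2 t + x^-1 *: hatA00 q1 p1 q2 p2
              + hatAinf) *m G.

Definition Bmx (p1 q2 p2 v : K) (U : 'M[K]_2) (t x : K) : 'M[K]_(2 + 2) :=
  let G := Gmx v U in
  - (t * x)^-1 *: (invmx G *m hatA0m1 p1 q2 p2 t *m G).

Definition Ham (q1 p1 q2 p2 t : K) : K :=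
  let Q := Qmx q1 q2 in let P := Pmx p1 q2 p2 in
  t^-1 * \tr (Q ^+ 2 * P ^+ 2
              - (Q ^+ 2 - (th0 + 2%:R * thi1) *: Q - t%:M) * P
              - (th0 + thi1) *: Q).

Definition Umx_rhs (q1 p1 q2 p2 : K) : 'M[K]_2 :=
  mx22
    ((2%:R * p2 * q1 - p1 + 1) * q1)
    (p1 - 2%:R * p2 * q1 - 1)
    (2%:R * q1 * (p2 * q2 - th0 - thi1 - thi2) - (p1 - 1) * q2)
    (2%:R * p2 * q2 + (p1 - 1) * q1 + th0 + 2%:R * thi1).

Definition v_rhs (q1 p1 q2 p2 : K) : K :=
  2%:R * p2 * (q1 ^+ 2 - q2) - 2%:R * (p1 - 1) * q1 + th0 + 2%:R * thi2.

End MatrixPIIID6.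

Section Systems.
Variables (K : numFieldType) (th0 thi1 thi2 thi3 : K).
Variables (q1 p1 q2 p2 v : K -> K) (U : K -> 'M[K]_2).

Definition compatible_at (t x : K) : Prop :=
  let A s y := Amx th0 thi1 thi2 thi3
                 (q1 s) (p1 s) (q2 s) (p2 s) (v s) (U s) s y in
  let B s y := Bmx th0 thi1 thi2 (p1 s) (q2 s) (p2 s) (v s) (U s) s y in
  derive1 (fun s => A s x) t - derive1 (fun y => B t y) x
    + (A t x *m B t x - B t x *m A t x) = 0.

Definition hamiltonian_system_at (t : K) : Prop :=
  let H := Ham th0 thi1 thi2 in
  [/\ derive1 q1 t = derive1 (fun p => H (q1 t) p (q2 t) (p2 t) t) (p1 t),
      derive1 p1 t = - derive1 (fun q => H q (p1 t) (q2 t) (p2 t) t) (q1 t),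
      derive1 q2 t = derive1 (fun p => H (q1 t) (p1 t) (q2 t) p t) (p2 t)
    & derive1 p2 t = - derive1 (fun q => H (q1 t) (p1 t) q (p2 t) t) (q2 t)].

Definition gauge_system_at (t : K) : Prop :=
  t *: derive1 U t
    = Umx_rhs th0 thi1 thi2 (q1 t) (p1 t) (q2 t) (p2 t) *m U t
  /\ t / v t * derive1 v t = v_rhs th0 thi2 (q1 t) (p1 t) (q2 t) (p2 t).

End Systems.

(* Main.v *)
Require Import Defs.
From HB Require Import structures.
From mathcomp Require Import all_boot all_order all_algebra.
From mathcomp Require Import complex.
From mathcomp Require Import all_classical reals topology normedtype derive.
From mathcomp Require Import perm ring.

Set Implicit Arguments.
Unset Strict Implicit.
Unset Printing Implicit Defensive.

Import Order.TTheory GRing.Theory Num.Theory.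
Import numFieldNormedType.Exports.

Local Open Scope classical_set_scope.
Local Open Scope ring_scope.

(** The systems are written in the frame of the gauge matrix G. With
    W = G' G^-1 and A = G^-1 M G, B = - (t x)^-1 G^-1 N1 G, the curvature
    A_t - B_x + [A, B] is the conjugate by G of
      M_t + [M, W] - N1 / (t x^2) - [M, N1] / (t x),
    where M = N1 / x^2 + A0 / x + A_inf. The x^-3 term is [N1, N1] = 0 and the
    x^0 term is [A_inf, W] = 0 as W is block diagonal, so only the
    coefficients of x^-2 and x^-1 remain ([compatible_curvature]), and the
    values x = 1 and x = -1 separate them.

    Write N1 = t N with N = (I; P)(I - P, I), and t W = S + T (block sum). The
    relation [P, Q] = Theta + theta^0 + theta^oo_1, a consequence of the linear
    relation between the parameters ([Pmx_Qmx_commutator]), turns the vanishing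
    of the two coefficients into three 2 x 2 matrix equations
    ([zero_curvatureP]), with c = theta^0 + 2 theta^oo_1 and
    d = theta^0 + theta^oo_1:
      S    = T + 2 QP - Q + c,
      t Q' = [T, Q] + 2 QPQ - Q^2 + c Q + t,
      t P' = [T, P] - 2 PQP + QP + PQ - c P + d.
    They are solved for S, Q', P' by three of the eight blocks; the other
    blocks then hold identically, among them the one with the derivative of Z,
    or because T and Theta are both diagonal.

    Up to the commutators with T = diag(tau, 0), the last two equations are the
    matrix form of the Hamiltonian flow. The upper right entry of Q is
    constantly 1, so that entry of the second equation determines tau, which
    is the equation for v; the other entries are the scalar Hamiltonian system
    ([matrix_hamiltonP]), and the first equation becomes the equation for U. *)

(** * Derivatives of matrix-valued functions *)

Section DeriveMatrix.
Variable K : numFieldType.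

(** Taking an entry is continuous and linear, so it commutes with the limit of
    the difference quotients. *)
Lemma is_derive_coord m n (M : K -> 'M[K]_(m, n)) (t : K)
    (dM : 'M[K]_(m, n)) i j :
  is_derive t 1 M dM -> is_derive t 1 (fun s => M s i j) (dM i j).
Proof.
case=> Mt <-.
have Mij : h^-1 *: (M (h *: 1 + t) i j - M t i j) @[h --> 0^'] -->
    ('D_1 M t) i j.
  rewrite (_ : (fun h => _) = (fun A : 'M[K]_(m, n) => A i j) \o
    (fun h => h^-1 *: ((M \o shift t) (h *: 1) - M t))); last first.
    by apply/funext => h /=; rewrite !mxE.
  exact: (cvg_comp _ _ Mt (@coord_continuous _ _ _ i j _)).
by apply: DeriveDef; [apply/cvg_ex; exists (('D_1 M t) i j) | apply: cvg_lim].
Qed.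

(** The converse: a matrix is the finite sum of its entries times elementary
    matrices, and the value of the derivative is read off entrywise. *)
Lemma is_derive_mx m n (M : K -> 'M[K]_(m, n)) (t : K)
    (dM : 'M[K]_(m, n)) :
  (forall i j, is_derive t 1 (fun s => M s i j) (dM i j)) ->
  is_derive t 1 M dM.
Proof.
move=> dMij; have Mt : derivable M t 1.
  rewrite (_ : M = \sum_i \sum_j (fun s => M s i j *: delta_mx i j)).
    apply: derivable_sum => i; apply: derivable_sum => j.
    by apply/derivable1_diffP/differentiableZl/derivable1_diffP.
  apply/funext => s; rewrite fct_sumE [LHS]matrix_sum_delta.
  by apply: eq_bigr => i _; rewrite fct_sumE.
apply: DeriveDef => //; apply/matrixP => i j.
have := is_derive_coord i j (derivableP Mt).
by move=> /@derive_val <-; apply: derive_val.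
Qed.

Lemma is_derive_mulmx m n p (M : K -> 'M[K]_(m, n)) (N : K -> 'M[K]_(n, p))
    (t : K) (dM : 'M[K]_(m, n)) (dN : 'M[K]_(n, p)) :
  is_derive t 1 M dM -> is_derive t 1 N dN ->
  is_derive t 1 (fun s => M s *m N s) (dM *m N t + M t *m dN).
Proof.
move=> Mt Nt; apply: is_derive_mx => i j.
rewrite (_ : (fun s => _) = \sum_k (fun s => M s i k * N s k j)); last first.
  by apply/funext => s; rewrite fct_sumE mxE.
rewrite !mxE -big_split /=; apply: is_derive_sum => k.
have dMik := is_derive_coord i k Mt; have dNkj := is_derive_coord k j Nt.
apply: (is_derive_eq (is_deriveM dMik dNkj)).
by rewrite addrC [_ *: dM _ _]mulrC.
Qed.

Lemma is_derive_scale m n (f : K -> K) (M : K -> 'M[K]_(m, n)) (t df : K)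
    (dM : 'M[K]_(m, n)) :
  is_derive t 1 f df -> is_derive t 1 M dM ->
  is_derive t 1 (fun s => f s *: M s) (df *: M t + f t *: dM).
Proof.
move=> ft Mt; apply: is_derive_mx => i j.
under eq_fun do rewrite mxE.
have := is_deriveM ft (is_derive_coord i j Mt).
by move/is_derive_eq; apply; rewrite !mxE addrC; congr (_ + _); rewrite mulrC.
Qed.

Lemma is_derive_col_mx m1 m2 n (M : K -> 'M[K]_(m1, n)) (N : K -> 'M[K]_(m2, n))
    (t : K) (dM : 'M[K]_(m1, n)) (dN : 'M[K]_(m2, n)) :
  is_derive t 1 M dM -> is_derive t 1 N dN ->
  is_derive t 1 (fun s => col_mx (M s) (N s)) (col_mx dM dN).
Proof.
move=> Mt Nt; apply: is_derive_mx => i j; rewrite [X in is_derive _ _ _ X]mxE.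
under eq_fun do rewrite mxE.
by case: (fintype.split i) => k; apply: is_derive_coord.
Qed.

Lemma is_derive_row_mx m n1 n2 (M : K -> 'M[K]_(m, n1)) (N : K -> 'M[K]_(m, n2))
    (t : K) (dM : 'M[K]_(m, n1)) (dN : 'M[K]_(m, n2)) :
  is_derive t 1 M dM -> is_derive t 1 N dN ->
  is_derive t 1 (fun s => row_mx (M s) (N s)) (row_mx dM dN).
Proof.
move=> Mt Nt; apply: is_derive_mx => i j; rewrite [X in is_derive _ _ _ X]mxE.
under eq_fun do rewrite mxE.
by case: (fintype.split j) => k; apply: is_derive_coord.
Qed.

Lemma is_derive_mx22 (a b c d : K -> K) (t da db dc dd : K) :
  is_derive t 1 a da -> is_derive t 1 b db ->
  is_derive t 1 c dc -> is_derive t 1 d dd ->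
  is_derive t 1 (fun s => mx22 (a s) (b s) (c s) (d s)) (mx22 da db dc dd).
Proof.
move=> at_ bt ct dt; apply: is_derive_mx => i j; rewrite mxE.
under eq_fun do rewrite mxE.
by case: eqP; case: eqP.
Qed.

Lemma derivable_det n (M : K -> 'M[K]_n) (t : K) :
  (forall i j, derivable (fun s => M s i j) t 1) ->
  derivable (fun s => \det (M s)) t 1.
Proof.
move=> Mt.
have -> : (fun s => \det (M s)) =
    \sum_(p : 'S_n) (cst ((-1) ^+ p) * \prod_i (fun s => M s i (p i))).
  by apply/funext => s; rewrite fct_sumE; apply: eq_bigr => p _;
     rewrite -[RHS]/(_ * _) fct_prodE.
elim/big_rec: _ => [|p F _ Ft]; first exact: derivable_cst.
apply: derivableD Ft; apply: derivableM; first exact: derivable_cst.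
elim/big_rec: _ => [|i F' _ Ft']; first exact: derivable_cst.
exact: derivableM.
Qed.

(** Cramer's rule shows that the inverse is derivable; differentiating
    [M *m invmx M = 1] then gives the value. *)
Lemma is_derive_invmx n (M : K -> 'M[K]_n) (t : K) (dM : 'M[K]_n) :
  (\forall s \near t, M s \in unitmx) -> is_derive t 1 M dM ->
  is_derive t 1 (fun s => invmx (M s)) (- (invmx (M t) *m dM *m invmx (M t))).
Proof.
move=> Mu Mt; have Mij i j : derivable (fun s => M s i j) t 1.
  by have [] := is_derive_coord i j Mt.
have Mut : M t \in unitmx by exact: nbhs_singleton Mu.
have invt : derivable (fun s => invmx (M s)) t 1.
  pose N s := (\det (M s))^-1 *: \adj (M s).
  apply: (@near_eq_derivable _ _ _ N).
    by near=> s; rewrite /N /invmx ifT//; near: s.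
  suff NE i j : derivable (fun s => N s i j) t 1.
    suff : is_derive t 1 N (\matrix_(i, j) 'D_1 (fun s => N s i j) t) by case.
    by apply: is_derive_mx => i j; rewrite mxE; apply: derivableP.
  rewrite (_ : (fun s => _) = (fun s => (\det (M s))^-1) *
      (cst ((-1) ^+ (j + i)) * (fun s => \det (row' j (col' i (M s)))))).
    apply: derivableM.
      apply: derivableV; last exact: derivable_det.
      by move: Mut; rewrite unitmxE unitfE.
    apply: derivableM; first exact: derivable_cst.
    apply: derivable_det => k l; under eq_fun do rewrite !mxE.
    exact: Mij.
  by apply/funext => s; rewrite /N !mxE.
have [_ inv1] := is_derive_mulmx Mt (derivableP invt).
apply: (is_derive_eq (derivableP invt)).
have : 'D_1 (fun s => M s *m invmx (M s)) t = 0.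
  rewrite -(derive_cst (1%:M : 'M[K]_n) t 1); apply: near_eq_derive.
  by near=> s; rewrite mulmxV//; near: s.
rewrite inv1 => /(congr1 (mulmx (invmx (M t)))).
rewrite mulmx0 mulmxDr mulmxA mulKmx// => /eqP.
by rewrite addrC addr_eq0 => /eqP.
Unshelve. all: by end_near. Qed.

End DeriveMatrix.

(** * Calculus of 2 x 2 matrices *)

Section Matrix22.
Variable K : numFieldType.
Implicit Types (a b c d x : K) (A B : 'M[K]_2).

Lemma mx22_eta A : A = mx22 (A 0 0) (A 0 1) (A 1 0) (A 1 1).
Proof.
apply/matrixP => -[[|[|//]] ltn_i] [[|[|//]] ltn_j]; rewrite mxE /=.
all: by congr (A _ _); apply: val_inj.
Qed.

Lemma eq_mx22 a b c d a' b' c' d' :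
  mx22 a b c d = mx22 a' b' c' d' <-> [/\ a = a', b = b', c = c' & d = d'].
Proof.
split=> [/matrixP AB|[-> -> -> ->] //].
by split; [have := AB 0 0|have := AB 0 1|have := AB 1 0|have := AB 1 1];
   rewrite !mxE.
Qed.

Lemma mx22D a b c d a' b' c' d' :
  mx22 a b c d + mx22 a' b' c' d' = mx22 (a + a') (b + b') (c + c') (d + d').
Proof. by apply/matrixP => i j; rewrite !mxE; do 2!case: ifP. Qed.

Lemma mx22N a b c d : - mx22 a b c d = mx22 (- a) (- b) (- c) (- d).
Proof. by apply/matrixP => i j; rewrite !mxE; do 2!case: ifP. Qed.

Lemma mx22Z x a b c d :
  x *: mx22 a b c d = mx22 (x * a) (x * b) (x * c) (x * d).
Proof. by apply/matrixP => i j; rewrite !mxE; do 2!case: ifP. Qed.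

Lemma mx22M a b c d a' b' c' d' :
  mx22 a b c d *m mx22 a' b' c' d' =
  mx22 (a * a' + b * c') (a * b' + b * d') (c * a' + d * c') (c * b' + d * d').
Proof.
apply/matrixP => i j; rewrite !mxE !big_ord_recl big_ord0 !mxE /= addr0.
by case: ifP; case: ifP.
Qed.

Lemma mx22_scalar x : x%:M = mx22 x 0 0 x.
Proof.
by apply/matrixP => -[[|[|//]] ltn_i] [[|[|//]] ltn_j]; rewrite !mxE.
Qed.

Lemma mx22_0 : 0 = mx22 0 0 0 0 :> 'M[K]_2.
Proof. by apply/matrixP => i j; rewrite !mxE; do 2!case: ifP. Qed.

Lemma det_mx22 a b c d : \det (mx22 a b c d) = a * d - b * c.
Proof.
rewrite (expand_det_row _ 0) !big_ord_recl big_ord0 /cofactor !det_mx11 !mxE /=.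
by rewrite addr0 expr0 mul1r expr1 mulN1r mulrN.
Qed.

Lemma mxtrace_mx22 a b c d : \tr (mx22 a b c d) = a + d.
Proof. by rewrite /mxtrace !big_ord_recl big_ord0 !mxE /= addr0. Qed.

End Matrix22.

Definition mx22E := (mx22_0, mx22_scalar, mx22D, mx22N, mx22Z, mx22M).

Ltac mx22_entries A :=
  rewrite (mx22_eta A); move: (A 0 0) (A 0 1) (A 1 0) (A 1 1) => ? ? ? ?.

(** Noncommutative polynomial identities between 2 x 2 matrices are proved on
    entries, where they are commutative polynomial identities. *)
Ltac mx22_ring :=
  repeat match goal with
  | A : matrix _ _ _ |- context [?B] => constr_eq A B; mx22_entries A
  end;
  rewrite ?mx22E; apply/eq_mx22; split; ring.

(** * Zero curvature in block form *)

Lemma block_mx_eq0 (V : nmodType) m1 m2 n1 n2 (A : 'M[V]_(m1, n1)) B C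
    (D : 'M[V]_(m2, n2)) :
  block_mx A B C D = 0 <-> [/\ A = 0, B = 0, C = 0 & D = 0].
Proof.
split=> [|[-> -> -> ->]]; last exact: block_mx0.
by rewrite -[0]block_mx0 => /eq_block_mx.
Qed.

Section ZeroCurvature.
Variables (K : numFieldType) (th0 thi1 : K).
Implicit Types P Q Theta S T X Y : 'M[K]_2.

(** [hatA0m1] at [t] is [t *: lead P]. *)
Definition lead P : 'M[K]_(2 + 2) := col_mx 1%:M P *m row_mx (1%:M - P) 1%:M.

(** In this section the prefix [d] marks the derivative along [P' = X] and
    [Q' = Y]. *)
Definition dlead P X : 'M[K]_(2 + 2) :=
  col_mx 0 X *m row_mx (1%:M - P) 1%:M + col_mx 1%:M P *m row_mx (- X) 0.

Definition Zblock P Q : 'M[K]_2 :=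
  (Q *m P + (th0 + 2%:R * thi1)%:M) *m P - (Q *m P + (th0 + thi1)%:M).

Definition dZblock P Q X Y : 'M[K]_2 :=
  (Y *m P + Q *m X) *m P + (Q *m P + (th0 + 2%:R * thi1)%:M) *m X
  - (Y *m P + Q *m X).

Definition residue P Q Theta : 'M[K]_(2 + 2) :=
  block_mx (- thi1)%:M (- Q) (- Zblock P Q) (- Theta).

Definition dresidue P Q X Y : 'M[K]_(2 + 2) :=
  block_mx 0 (- Y) (- dZblock P Q X Y) 0.

(** The coefficients of x^-2 and of (t x)^-1 in the curvature, for a gauge
    connection t^-1 diag(S, T), with [X] and [Y] standing for t P' and t Q'. In
    the former, the term [lead P] that arises from differentiating the factor t
    of t [lead P] cancels against the x-derivative of B. *)
Definition curvature2 P Q Theta S T X : 'M[K]_(2 + 2) :=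
  let N := lead P in let A := residue P Q Theta in let W := block_mx S 0 0 T in
  dlead P X + (N *m W - W *m N) - (A *m N - N *m A).

Definition curvature1 t P Q Theta S T X Y : 'M[K]_(2 + 2) :=
  let N := lead P in let A := residue P Q Theta in let W := block_mx S 0 0 T in
  dresidue P Q X Y + (A *m W - W *m A)
  - t *: (hatAinf K *m N - N *m hatAinf K).

(** The upper right block of [curvature2] is linear in [S] with coefficient -1,
    its lower right block contains [X] once, and the upper right block of
    [curvature1] contains [Y] once: these three blocks give the equations. For
    the converse, [Theta] is eliminated by the commutation relation, [S], [X]
    and [Y] by the equations, and every block becomes an identity in [P], [Q]
    and [T], except the lower right block of [curvature1], which is the
    hypothesis that [T] and [Theta] commute. *)
Lemma zero_curvatureP t P Q Theta S T X Y (c := th0 + 2%:R * thi1)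
    (d := th0 + thi1) :
  P *m Q = Q *m P + Theta + d%:M -> T *m Theta = Theta *m T ->
  (curvature2 P Q Theta S T X = 0 /\ curvature1 t P Q Theta S T X Y = 0)
  <->
  [/\ S = T + 2%:R *: (Q *m P) - Q + c%:M,
      Y = T *m Q - Q *m T + 2%:R *: (Q *m P *m Q) - Q *m Q + c *: Q + t%:M &
      X = T *m P - P *m T - 2%:R *: (P *m Q *m P) + Q *m P + P *m Q - c *: P
          + d%:M].
Proof.
move=> PQ TTheta; subst c d.
have ThetaE : Theta = P *m Q - Q *m P - (th0 + thi1)%:M.
  by rewrite PQ; mx22_ring.
rewrite /curvature2 /curvature1 /dlead /lead /residue /dresidue /hatAinf /=.
rewrite !mul_col_row.
rewrite !(mulmx_block, add_block_mx, opp_block_mx, scale_block_mx).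
rewrite !block_mx_eq0.
rewrite !(mulmx0, mul0mx, mulmx1, mul1mx, add0r, addr0, subr0, sub0r, oppr0).
rewrite !scaler0 ?addr0 ?subr0.
split.
  case=> -[_ e12 _ e22] [_ f12 _ _].
  have SE : S = T + 2%:R *: (Q *m P) - Q + (th0 + 2%:R * thi1)%:M.
    apply/subr0_eq; rewrite -oppr0 -[in RHS]e12 ThetaE; mx22_ring.
  split=> //; apply/subr0_eq.
    by rewrite -oppr0 -[in RHS]f12 SE; mx22_ring.
  by rewrite -[RHS]e22 ThetaE /Zblock; mx22_ring.
case=> SE YE XE; split; split.
- by rewrite XE SE /Zblock; mx22_ring.
- by rewrite SE ThetaE; mx22_ring.
- by rewrite XE SE ThetaE /Zblock; mx22_ring.
- by rewrite XE ThetaE /Zblock; mx22_ring.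
- by mx22_ring.
- by rewrite YE SE; mx22_ring.
- by rewrite /dZblock YE XE SE /Zblock; mx22_ring.
- by rewrite mulNmx mulmxN opprK TTheta addNr.
Qed.
End ZeroCurvature.

(** * Passage to the frame of the gauge matrix *)

Section Gauge.
Variable K : numFieldType.

(** In the frame of [G], differentiation becomes the covariant derivative
    [dM + [M, W]] with connection matrix [W = dG *m invmx G]. *)
Lemma is_derive_conj n (G M : K -> 'M[K]_n) (t : K) (W dM : 'M[K]_n) :
  (\forall s \near t, G s \in unitmx) ->
  is_derive t 1 G (W *m G t) -> is_derive t 1 M dM ->
  is_derive t 1 (fun s => invmx (G s) *m M s *m G s)
    (invmx (G t) *m (dM + (M t *m W - W *m M t)) *m G t).
Proof.
move=> Gu dG Mt; have Gut : G t \in unitmx by exact: nbhs_singleton Gu.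
have dGi := is_derive_invmx Gu dG.
apply: (is_derive_eq (is_derive_mulmx (is_derive_mulmx dGi Mt) dG)).
rewrite !mulmxA mulmxK//.
rewrite !(mulmxDr, mulmxDl, mulmxN, mulNmx, mulmxA).
by rewrite -!addrA addrC -!addrA; congr (_ + _); rewrite addrC.
Qed.

(** The rest of the curvature in the same frame: [L] stands for the covariant
    derivative, [a] and [b] for the scalar factors of [N] in the x-derivative
    of B and in B. *)
Lemma conj_curvature_eq0 n (G M L N : 'M[K]_n) (a b : K) : G \in unitmx ->
  invmx G *m L *m G - a *: (invmx G *m N *m G)
    + (invmx G *m M *m G *m (b *: (invmx G *m N *m G))
       - b *: (invmx G *m N *m G) *m (invmx G *m M *m G)) = 0
  <-> L - a *: N + b *: (M *m N - N *m M) = 0.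
Proof.
move=> Gu; have conjM X Y :
    (invmx G *m X *m G) *m (invmx G *m Y *m G) = invmx G *m (X *m Y) *m G.
  by rewrite !mulmxA mulmxK.
have conjZ c X : c *: (invmx G *m X *m G) = invmx G *m (c *: X) *m G.
  by rewrite -scalemxAr -scalemxAl.
have conj_eq0 X : invmx G *m X *m G = 0 <-> X = 0.
  split=> [X0|->]; last by rewrite mulmx0 mul0mx.
  by rewrite -[X](mulKVmx Gu) -[_ *m X](mulmxK Gu) X0 mul0mx mulmx0.
rewrite -scalemxAr -scalemxAl !conjM -scalerBr -mulmxBl -mulmxBr.
rewrite !conjZ -mulmxBl -mulmxBr -mulmxDl -mulmxDr.
exact: conj_eq0.
Qed.

End Gauge.

Section Compatibility.
Variables (K : numFieldType) (th0 thi1 thi2 thi3 : K).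
Variables (q1 p1 q2 p2 v : K -> K) (U : K -> 'M[K]_2) (t : K).

Let Qf s := Qmx (q1 s) (q2 s).
Let Pf s := Pmx th0 thi1 thi2 (p1 s) (q2 s) (p2 s).
Let Gf s := Gmx (v s) (U s).

Lemma is_derive_hatA0m1 (dP : 'M[K]_2) : is_derive t 1 Pf dP ->
  is_derive t 1 (fun s => hatA0m1 th0 thi1 thi2 (p1 s) (q2 s) (p2 s) s)
    (lead (Pf t) + dlead (Pf t) (t *: dP)).
Proof.
move=> Pt.
have -> : (fun s => hatA0m1 th0 thi1 thi2 (p1 s) (q2 s) (p2 s) s) =
    (fun s => s *: lead (Pf s)).
  by apply/funext => s; rewrite /hatA0m1 scalemxAr scale_row_mx scalemx1.
have c0 m n (M : 'M[K]_(m, n)) := is_derive_cst M t 1.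
have colP := is_derive_col_mx (c0 _ _ 1%:M) Pt.
have rowP := is_derive_row_mx (is_deriveB (c0 _ _ 1%:M) Pt) (c0 _ _ 1%:M).
have tN := is_derive_scale (is_derive_id t 1) (is_derive_mulmx colP rowP).
apply: (is_derive_eq tN).
rewrite scale1r; congr (_ + _); rewrite scalerDr /dlead; congr (_ + _).
  by rewrite scalemxAl scale_col_mx scaler0.
by rewrite scalemxAr scale_row_mx scaler0 sub0r scalerN.
Qed.

Lemma is_derive_hatA00 (dP dQ : 'M[K]_2) :
  is_derive t 1 Pf dP -> is_derive t 1 Qf dQ ->
  is_derive t 1 (fun s => hatA00 th0 thi1 thi2 thi3 (q1 s) (p1 s) (q2 s) (p2 s))
    (dresidue th0 thi1 (Pf t) (Qf t) dP dQ).
Proof.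
move=> Pt Qt.
have c0 m n (M : 'M[K]_(m, n)) := is_derive_cst M t 1.
have QPt := is_derive_mulmx Qt Pt.
have Zt : is_derive t 1
    (fun s => Zmx th0 thi1 thi2 (q1 s) (p1 s) (q2 s) (p2 s))
    (dZblock th0 thi1 (Pf t) (Qf t) dP dQ).
  apply: (is_derive_eq (is_deriveB
    (is_derive_mulmx (is_deriveD QPt (c0 _ _ (th0 + 2%:R * thi1)%:M)) Pt)
    (is_deriveD QPt (c0 _ _ (th0 + thi1)%:M)))).
  by rewrite !addr0.
apply: (is_derive_eq (is_derive_col_mx
  (is_derive_row_mx (c0 _ _ (- thi1)%:M) (is_deriveN Qt))
  (is_derive_row_mx (is_deriveN Zt) (c0 _ _ (- Thetamx thi2 thi3))))).
by [].
Qed.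

(** The cancellation of the x^-3 and x^0 terms happens in the final [field]:
    the two products [N *m N] agree, and [AinfW] identifies the two products of
    [hatAinf] with the connection. *)
Lemma compatible_curvature (x : K) (dP dQ S T : 'M[K]_2) :
  t != 0 -> x != 0 ->
  is_derive t 1 Pf dP -> is_derive t 1 Qf dQ ->
  (\forall s \near t, Gf s \in unitmx) ->
  is_derive t 1 Gf ((t^-1 *: block_mx S 0 0 T) *m Gf t) ->
  compatible_at th0 thi1 thi2 thi3 q1 p1 q2 p2 v U t x <->
  x ^- 2 *: curvature2 th0 thi1 (Pf t) (Qf t) (Thetamx thi2 thi3) S T (t *: dP)
  + (x * t)^-1 *: curvature1 th0 thi1 t (Pf t) (Qf t) (Thetamx thi2 thi3) S T
      (t *: dP) (t *: dQ) = 0.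
Proof.
move=> t0 x0 Pt Qt Gu Gt.
have Gut : Gf t \in unitmx by exact: nbhs_singleton Gu.
pose N1 := hatA0m1 th0 thi1 thi2 (p1 t) (q2 t) (p2 t) t.
pose A0 := hatA00 th0 thi1 thi2 thi3 (q1 t) (p1 t) (q2 t) (p2 t).
pose N := lead (Pf t).
have N1E : N1 = t *: N.
  by rewrite /N1 /N /hatA0m1 /lead scalemxAr scale_row_mx scalemx1.
pose M s := x ^- 2 *: hatA0m1 th0 thi1 thi2 (p1 s) (q2 s) (p2 s) s +
  x^-1 *: hatA00 th0 thi1 thi2 thi3 (q1 s) (p1 s) (q2 s) (p2 s) + hatAinf K.
have Mt : is_derive t 1 M
    (x ^- 2 *: (N + dlead (Pf t) (t *: dP))
     + x^-1 *: dresidue th0 thi1 (Pf t) (Qf t) dP dQ).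
  rewrite -[X in is_derive _ _ _ X]addr0.
  exact: (is_deriveD (is_deriveD
    (is_deriveZ (x ^- 2) (is_derive_hatA0m1 Pt))
    (is_deriveZ x^-1 (is_derive_hatA00 Pt Qt)))
    (is_derive_cst (hatAinf K) t 1)).
have At := is_derive_conj Gu Gt Mt.
have Bt : is_derive x 1 (fun y => Bmx th0 thi1 thi2 (p1 t) (q2 t) (p2 t)
     (v t) (U t) t y) ((t^-1 * x ^- 2) *: (invmx (Gf t) *m N1 *m Gf t)).
  have xt : is_derive x 1 (fun y => - (t * y)^-1) (t^-1 * x ^- 2).
    have xV : is_derive x 1 (fun y => y^-1) (- x ^- 2).
      apply: DeriveDef; first exact: derivableV.
      by rewrite deriveV// derive_id scaler1.
    have xZ := is_deriveZ (- t^-1) xV.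
    have -> : (fun y => - (t * y)^-1) = - t^-1 \*: (fun y => y^-1).
      by apply/funext => y; rewrite invfM -mulNr.
    apply: (is_derive_eq xZ).
    by rewrite /GRing.scale /= mulrNN.
  have Mc := is_derive_cst (invmx (Gf t) *m N1 *m Gf t) x 1.
  apply: (is_derive_eq (is_derive_scale xt Mc)).
  by rewrite scaler0 addr0.
rewrite /compatible_at !derive1E.
rewrite [X in X - _](@derive_val _ _ _ _ _ _ _ At).
rewrite (@derive_val _ _ _ _ _ _ _ Bt).
rewrite conj_curvature_eq0//.
pose W := block_mx S 0 0 T.
have AinfW : hatAinf K *m W = W *m hatAinf K.
  by rewrite /W /hatAinf !mulmx_block !(mulmx0, mul0mx, addr0) mulmxN mulNmx
    mulmx1 mul1mx.
have dresidueZ : dresidue th0 thi1 (Pf t) (Qf t) (t *: dP) (t *: dQ) =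
    t *: dresidue th0 thi1 (Pf t) (Qf t) dP dQ.
  rewrite /dresidue /dZblock scale_block_mx !scaler0 !scalerN.
  rewrite -!scalemxAl -!scalemxAr.
  by rewrite -!scalerDr -scalemxAl -!scalerDr -scalerBr.
rewrite /curvature2 /curvature1 dresidueZ -/N -/W.
rewrite (_ : residue _ _ _ _ _ = A0) //.
set lhs := (X in X = 0); set rhs := (X in _ <-> X = 0).
suff -> : lhs = rhs by [].
have ME : M t = x ^- 2 *: (t *: N) + x^-1 *: A0 + hatAinf K by rewrite -N1E.
rewrite /lhs /rhs -/W ME -/N1 N1E.
rewrite !(mulmxDl, mulmxDr, =^~scalemxAl, =^~scalemxAr) AinfW.
(* What remains is linear in the products of matrices, which become atoms. *)
move: (dlead _ _) (dresidue _ _ _ _ _ _) (N *m W) (W *m N) (A0 *m W) (W *m A0).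
move: (W *m hatAinf K) (hatAinf K *m N) (N *m hatAinf K) (N *m N).
move: (A0 *m N) (N *m A0); generalize N => *.
apply/matrixP => i j; rewrite !mxE; field; exact/andP.
Qed.
End Compatibility.

(** * The Hamiltonian system *)

Section Hamiltonian.
Variables (K : numFieldType) (th0 thi1 thi2 : K).

(** The Hamiltonian has degree at most 2 in each canonical variable, so its
    partial derivatives are coefficients of exact Taylor expansions. *)
Lemma derive1_quadratic (f : K -> K) (x d e : K) :
  (forall y, f y = f x + d * (y - x) + e * (y - x) ^+ 2) -> derive1 f x = d.
Proof.
move=> fE; rewrite derive1E.
have -> : f = cst (f x) + d \*: (id - cst x) + e \*: (id - cst x) ^+ 2.
  apply/funext => y; rewrite fE.
  rewrite -[RHS]/(f x + d * (y - x) + e * ((id - cst x : K -> K) ^+ 2) y).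
  by rewrite exprfctE.
rewrite derive_val.
rewrite (_ : (id - cst x : K -> K) x = 0); last exact: subrr.
by rewrite mulr0 scale0r scaler0 add0r addr0 subr0; apply: mulr1.
Qed.

Let c := th0 + 2%:R * thi1.
Let d := th0 + thi1.
Let e := th0 + thi1 + thi2.

Lemma HamE (q1 p1 q2 p2 t : K) : Ham th0 thi1 thi2 q1 p1 q2 p2 t =
  t^-1 * (2%:R * (q1 ^+ 2 - q2) * ((p1 / 2%:R) ^+ 2 - p2 * (p2 * q2 - e))
          + (2%:R * q1 * (p1 - 1) + c) * (2%:R * p2 * q2 - e)
          + (c * q1 + t + q2 - q1 ^+ 2) * p1 - 2%:R * d * q1).
Proof.
rewrite /Ham /Qmx /Pmx !expr2 -!mulmxE !mx22E mxtrace_mx22 /c /d /e.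
by congr (_ * _); field.
Qed.

(** The partial derivatives of t H. *)
Definition dHp1 (q1 p1 q2 p2 t : K) :=
  (q1 ^+ 2 - q2) * (p1 - 1) + 2%:R * q1 * (2%:R * p2 * q2 - e) + c * q1 + t.

Definition dHq1 (q1 p1 q2 p2 : K) :=
  4%:R * q1 * ((p1 / 2%:R) ^+ 2 - p2 * (p2 * q2 - e))
  + 2%:R * (p1 - 1) * (2%:R * p2 * q2 - e) + (c - 2%:R * q1) * p1 - 2%:R * d.

Definition dHp2 (q1 p1 q2 p2 : K) :=
  2%:R * q2 * (2%:R * q1 * (p1 - 1) + c)
  - 2%:R * (q1 ^+ 2 - q2) * (2%:R * p2 * q2 - e).

Definition dHq2 (q1 p1 q2 p2 : K) :=
  2%:R * p2 * (2%:R * q1 * (p1 - 1) + c) + p1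
  - 2%:R * ((p1 / 2%:R) ^+ 2 - p2 * (p2 * q2 - e))
  - 2%:R * (q1 ^+ 2 - q2) * p2 ^+ 2.

Lemma derive1_Ham (q1 p1 q2 p2 t : K) (H := Ham th0 thi1 thi2) :
  [/\ derive1 (fun p => H q1 p q2 p2 t) p1 = t^-1 * dHp1 q1 p1 q2 p2 t,
      derive1 (fun q => H q p1 q2 p2 t) q1 = t^-1 * dHq1 q1 p1 q2 p2,
      derive1 (fun p => H q1 p1 q2 p t) p2 = t^-1 * dHp2 q1 p1 q2 p2 &
      derive1 (fun q => H q1 p1 q p2 t) q2 = t^-1 * dHq2 q1 p1 q2 p2].
Proof.
split.
- apply: (@derive1_quadratic _ _ _ (t^-1 * ((q1 ^+ 2 - q2) / 2%:R))) => y.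
  by rewrite /H !HamE /dHp1; move: (t^-1) => ?; field.
- apply: (@derive1_quadratic _ _ _ (t^-1 *
    (2%:R * ((p1 / 2%:R) ^+ 2 - p2 * (p2 * q2 - e)) - p1))) => y.
  by rewrite /H !HamE /dHq1; move: (t^-1) => ?; field.
- apply: (@derive1_quadratic _ _ _ (t^-1 *
    (- 2%:R * (q1 ^+ 2 - q2) * q2))) => y.
  by rewrite /H !HamE /dHp2; move: (t^-1) => ?; field.
- apply: (@derive1_quadratic _ _ _ (t^-1 * (2%:R * p2 ^+ 2))) => y.
  by rewrite /H !HamE /dHq2; move: (t^-1) => ?; field.
Qed.

Lemma hamiltonian_systemP (q1 p1 q2 p2 : K -> K) (t : K) : t != 0 ->
  hamiltonian_system_at th0 thi1 thi2 q1 p1 q2 p2 t <->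
  [/\ t * derive1 q1 t = dHp1 (q1 t) (p1 t) (q2 t) (p2 t) t,
      t * derive1 p1 t = - dHq1 (q1 t) (p1 t) (q2 t) (p2 t),
      t * derive1 q2 t = dHp2 (q1 t) (p1 t) (q2 t) (p2 t) &
      t * derive1 p2 t = - dHq2 (q1 t) (p1 t) (q2 t) (p2 t)].
Proof.
move=> t0; have tI (a b : K) : a = t^-1 * b <-> t * a = b.
  by split=> [->|<-]; rewrite ?mulVKf// mulKf.
have [Hp1 Hq1 Hp2 Hq2] := derive1_Ham (q1 t) (p1 t) (q2 t) (p2 t) t.
rewrite /hamiltonian_system_at /= Hp1 Hq1 Hp2 Hq2 -!mulrN.
by split=> -[E1 E2 E3 E4]; split; apply/tI.
Qed.

Lemma eq_of_scaled_diff (x y k a b : K) : a = b -> x - y = k * (a - b) -> x = y.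
Proof. by move=> -> /eqP; rewrite subrr mulr0 subr_eq0 => /eqP. Qed.

(** The upper right entry of the first equation, whose left-hand side is 0, is
    the value of [tau]. With this value, the diagonal gives q1' (twice) and the
    lower left entry q2'; in the second equation the diagonal gives p1' (twice)
    and the upper right entry p2'. The lower left entry of the second equation
    is redundant: the lower left entry of P expresses the value of the
    commutator of P and Q, which the flow preserves. *)
Lemma matrix_hamiltonP (q1 p1 q2 p2 t dq1 dp1 dq2 dp2 tau : K)
    (P := Pmx th0 thi1 thi2 p1 q2 p2) (Q := Qmx q1 q2)
    (T := mx22 tau 0 0 0) :
  (t *: mx22 dq1 0 (- dq2) dq1
     = T *m Q - Q *m T + 2%:R *: (Q *m P *m Q) - Q *m Q + c *: Q + t%:M /\
   t *: mx22 (dp1 / 2%:R) (- dp2) (dp2 * q2 + p2 * dq2) (dp1 / 2%:R)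
     = T *m P - P *m T - 2%:R *: (P *m Q *m P) + Q *m P + P *m Q - c *: P
       + d%:M)
  <->
  [/\ t * dq1 = dHp1 q1 p1 q2 p2 t, t * dp1 = - dHq1 q1 p1 q2 p2,
      t * dq2 = dHp2 q1 p1 q2 p2 & t * dp2 = - dHq2 q1 p1 q2 p2]
  /\ tau = v_rhs th0 thi2 q1 p1 q2 p2.
Proof.
rewrite /T /P /Q /Pmx /Qmx !mx22E !eq_mx22.
rewrite /dHp1 /dHq1 /dHp2 /dHq2 /v_rhs /c /d /e.
split.
  case=> -[b00 b01 b10 b11] [c00 c01 c10 c11].
  have tauE : tau = v_rhs th0 thi2 q1 p1 q2 p2.
    by apply: (eq_of_scaled_diff (k := -1) b01); rewrite /v_rhs; field.
  rewrite tauE /v_rhs in b00 b10 c00 c01 *.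
  split=> //; split.
  - by apply: (eq_of_scaled_diff (k := 1) b00); field.
  - by apply: (eq_of_scaled_diff (k := 2%:R) c00); field.
  - by apply: (eq_of_scaled_diff (k := -1) b10); field.
  - by apply: (eq_of_scaled_diff (k := -1) c01); field.
case=> -[E1 E2 E3 E4] ->.
split; split.
- by apply: (eq_of_scaled_diff (k := 1) E1); field.
- by field.
- by apply: (eq_of_scaled_diff (k := -1) E3); field.
- by apply: (eq_of_scaled_diff (k := 1) E1); field.
- by apply: (eq_of_scaled_diff (k := (2%:R : K)^-1) E2); field.
- by apply: (eq_of_scaled_diff (k := -1) E4); field.
- by rewrite mulrDr [t * (dp2 * _)]mulrA E4 [t * (p2 * _)]mulrCA E3; field.
- by apply: (eq_of_scaled_diff (k := (2%:R : K)^-1) E2); field.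
Qed.

End Hamiltonian.

(** * The equivalence *)

Section Pointwise.
Variables (K : numFieldType) (th0 thi1 thi2 thi3 : K).

Lemma Pmx_Qmx_commutator (q1 p1 q2 p2 : K) (P := Pmx th0 thi1 thi2 p1 q2 p2)
    (Q := Qmx q1 q2) :
  2%:R * th0 + 2%:R * thi1 + thi2 + thi3 = 0 ->
  P *m Q = Q *m P + Thetamx thi2 thi3 + (th0 + thi1)%:M.
Proof.
move=> hsum; have -> : thi3 = - (2%:R * th0 + 2%:R * thi1 + thi2).
  by apply/eqP; rewrite -addr_eq0 addrC hsum.
by rewrite /P /Q /Thetamx /Qmx /Pmx; mx22_ring.
Qed.

(** The equation for [S] with the value of [tau] substituted. *)
Lemma Umx_rhsE (q1 p1 q2 p2 : K) (P := Pmx th0 thi1 thi2 p1 q2 p2)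
    (Q := Qmx q1 q2) :
  mx22 (v_rhs th0 thi2 q1 p1 q2 p2) 0 0 0 + 2%:R *: (Q *m P) - Q
    + (th0 + 2%:R * thi1)%:M
  = Umx_rhs th0 thi1 thi2 q1 p1 q2 p2.
Proof.
rewrite /P /Q /Qmx /Pmx /v_rhs /Umx_rhs !mx22E; apply/eq_mx22.
by split; field.
Qed.

Variables (q1 p1 q2 p2 v : K -> K) (U : K -> 'M[K]_2) (t : K).

(** The equivalence holds at each point t separately: the values of the
    functions and of their derivatives at t enter only algebraically. *)
Lemma compatible_hamiltonian :
  2%:R * th0 + 2%:R * thi1 + thi2 + thi3 = 0 -> t != 0 ->
  derivable q1 t 1 -> derivable p1 t 1 -> derivable q2 t 1 ->
  derivable p2 t 1 -> derivable v t 1 -> derivable U t 1 ->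
  (\forall s \near t, v s != 0 /\ \det (U s) != 0) ->
  (forall x, x != 0 ->
     compatible_at th0 thi1 thi2 thi3 q1 p1 q2 p2 v U t x)
  <->
  hamiltonian_system_at th0 thi1 thi2 q1 p1 q2 p2 t /\
  gauge_system_at th0 thi1 thi2 q1 p1 q2 p2 v U t.
Proof.
move=> hsum t0 /derivableP q1t /derivableP p1t /derivableP q2t /derivableP p2t.
move=> /derivableP vt /derivableP Ut vU0.
rewrite -!derive1E in q1t p1t q2t p2t vt Ut.
have [vt0 Ut0] := nbhs_singleton vU0.
have Utu : U t \in unitmx by rewrite unitmxE unitfE.
pose P := Pmx th0 thi1 thi2 (p1 t) (q2 t) (p2 t); pose Q := Qmx (q1 t) (q2 t).
pose dQ := mx22 (derive1 q1 t) 0 (- derive1 q2 t) (derive1 q1 t).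
pose dP := mx22 (derive1 p1 t / 2%:R) (- derive1 p2 t)
  (derive1 p2 t * q2 t + p2 t * derive1 q2 t) (derive1 p1 t / 2%:R).
have Qt : is_derive t 1 (fun s => Qmx (q1 s) (q2 s)) dQ.
  exact: (is_derive_mx22 q1t (is_derive_cst _ _ _) (is_deriveN q2t) q1t).
have Pt : is_derive t 1 (fun s => Pmx th0 thi1 thi2 (p1 s) (q2 s) (p2 s)) dP.
  have p1h : is_derive t 1 (fun s => p1 s / 2%:R) (derive1 p1 t / 2%:R).
    apply: (is_derive_eq (is_deriveM p1t (is_derive_cst _ _ _))).
    by rewrite scaler0 add0r mulrC.
  have c0 (a : K) := is_derive_cst a t 1.
  have pq := is_deriveB (is_deriveB (is_deriveB (is_deriveM p2t q2t) (c0 th0))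
    (c0 thi1)) (c0 thi2).
  apply: (is_derive_eq (is_derive_mx22 p1h (is_deriveN p2t) pq p1h)).
  by rewrite !subr0 addrC [_ *: derive1 p2 t]mulrC.
pose S := t *: (derive1 U t *m invmx (U t)).
pose tau := t / v t * derive1 v t.
pose T := mx22 tau 0 0 0.
have Gt : is_derive t 1 (fun s => Gmx (v s) (U s))
    ((t^-1 *: block_mx S 0 0 T) *m Gmx (v t) (U t)).
  have c0 m n (M : 'M[K]_(m, n)) := is_derive_cst M t 1.
  have ct (a : K) := is_derive_cst a t 1.
  have dvt := is_derive_mx22 vt (ct 0) (ct 0) (ct 1).
  apply: (is_derive_eq (is_derive_col_mx (is_derive_row_mx Ut (c0 _ _ 0))
    (is_derive_row_mx (c0 _ _ 0) dvt))).
  rewrite -[LHS]/(block_mx _ _ _ _) /Gmx scale_block_mx mulmx_block.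
  rewrite !(mulmx0, mul0mx, scaler0, addr0, add0r) /S scalerA mulVf// scale1r.
  rewrite mulmxKV//; congr block_mx; rewrite /T /tau !mx22E; apply/eq_mx22.
  by split; field; rewrite ?vt0 ?t0.
have Gu : \forall s \near t, Gmx (v s) (U s) \in unitmx.
  apply: filterS vU0 => s [vs Us].
  rewrite unitmxE /Gmx det_ublock unitfE mulf_neq0//.
  by rewrite det_mx22 mulr1 mul0r subr0.
have compE x : x != 0 -> _ := fun x0 =>
  compatible_curvature thi3 t0 x0 Pt Qt Gu Gt.
transitivity (curvature2 th0 thi1 P Q (Thetamx thi2 thi3) S T (t *: dP) = 0 /\
  curvature1 th0 thi1 t P Q (Thetamx thi2 thi3) S T (t *: dP) (t *: dQ) = 0).
  (* x = 1 and x = -1 separate the two coefficients. *)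
  split=> [comp|[E2 E1] x x0]; last first.
    by apply/(compE _ x0); rewrite E1 E2 !scaler0 addr0.
  have /(compE _ (oner_neq0 _)) := comp 1 (oner_neq0 _).
  have N1 : -1 != 0 :> K by rewrite oppr_eq0 oner_neq0.
  have /(compE _ N1) := comp _ N1.
  rewrite sqrrN expr1n invr1 !scale1r mulN1r mul1r invrN scaleNr.
  set E2 := curvature2 _ _ _ _ _ _ _ _.
  set E1 := curvature1 _ _ _ _ _ _ _ _ _ _.
  move=> /eqP; rewrite subr_eq0 => /eqP E12; rewrite -E12 -mulr2n -scaler_nat.
  move=> /eqP; rewrite scaler_eq0 pnatr_eq0 /= => /eqP E20; split=> //.
  move/esym/eqP: E12; rewrite E20 scaler_eq0 invr_eq0 (negPf t0) /=.
  by move/eqP.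
have TTheta : T *m Thetamx thi2 thi3 = Thetamx thi2 thi3 *m T.
  by rewrite /T /Thetamx; mx22_ring.
rewrite (zero_curvatureP t S (t *: dP) (t *: dQ)
  (Pmx_Qmx_commutator _ _ _ _ hsum) TTheta).
have SE : (S = Umx_rhs th0 thi1 thi2 (q1 t) (p1 t) (q2 t) (p2 t)) <->
    t *: derive1 U t = Umx_rhs th0 thi1 thi2 (q1 t) (p1 t) (q2 t) (p2 t) *m U t.
  rewrite /S scalemxAl; split=> [<-|->]; first by rewrite mulmxKV.
  by rewrite mulmxK.
have hamE := matrix_hamiltonP th0 thi1 thi2 (q1 t) (p1 t) (q2 t) (p2 t) t
  (derive1 q1 t) (derive1 p1 t) (derive1 q2 t) (derive1 p2 t) tau.
rewrite (hamiltonian_systemP _ _ _ _ _ _ _ t0) /gauge_system_at.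
split.
  case=> SE' YE XE; have [ham tauE] := hamE.1 (conj YE XE).
  split=> //; split=> //; apply/SE.
  by rewrite SE' /T tauE Umx_rhsE.
case=> ham [/SE SE']; rewrite -/tau => tauE.
have [YE XE] := hamE.2 (conj ham tauE).
by split=> //; rewrite SE' /T tauE Umx_rhsE.
Qed.

End Pointwise.

Theorem mainTheorem2 (R : realType) (th0 thi1 thi2 thi3 : Cplx R)
    (hsum : 2%:R * th0 + 2%:R * thi1 + thi2 + thi3 = 0)
    (hneq : thi2 != thi3)
    (D : set (Cplx R)) (hD : complex_domain D) (hD0 : D `<=` [set t | t != 0])
    (q1 p1 q2 p2 v : Cplx R -> Cplx R) (U : Cplx R -> 'M[Cplx R]_2)
    (hq1 : holomorphic_on D q1) (hp1 : holomorphic_on D p1)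
    (hq2 : holomorphic_on D q2) (hp2 : holomorphic_on D p2)
    (hv : holomorphic_on D v) (hU : holomorphic_on D U)
    (hv0 : forall t, D t -> v t != 0)
    (hU0 : forall t, D t -> \det (U t) != 0) :
  (forall t x, D t -> x != 0 ->
     compatible_at th0 thi1 thi2 thi3 q1 p1 q2 p2 v U t x)
  <->
  (forall t, D t ->
     hamiltonian_system_at th0 thi1 thi2 q1 p1 q2 p2 t /\
     gauge_system_at th0 thi1 thi2 q1 p1 q2 p2 v U t).
Proof.
have [openD _ _] := hD.
have pointwise t : D t ->
    (forall x, x != 0 ->
       compatible_at th0 thi1 thi2 thi3 q1 p1 q2 p2 v U t x) <->
    hamiltonian_system_at th0 thi1 thi2 q1 p1 q2 p2 t /\
    gauge_system_at th0 thi1 thi2 q1 p1 q2 p2 v U t.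
  move=> Dt; apply: (compatible_hamiltonian hsum).
  - exact: hD0.
  - exact: hq1.
  - exact: hp1.
  - exact: hq2.
  - exact: hp2.
  - exact: hv.
  - exact: hU.
  - apply: filterS (open_nbhs_nbhs (conj openD Dt)) => s Ds.
    by split; [exact: hv0|exact: hU0].
split=> [comp t Dt|sys t x Dt x0].
  exact: ((pointwise t Dt).1 (fun x x0 => comp t x Dt x0)).
exact: ((pointwise t Dt).2 (sys t Dt) x x0).
Qed.
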